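(* Assume that the following conditions are fulfilled: (a) $a\in\mathbb{R}^{\ell}$, $F\subseteq\mathbb{R}^{\ell}$ is a nonempty closed set. (b) $H$ is a proper closed subset of $\mathbb{R}^{\ell}$ with $k\in\operatorname{core}0^+H$, where $k\in 0^+H\setminus\{0\}$. (c) There exist a polyhedral cone $C\subset\mathbb{R}^{\ell}$, some $z\in\operatorname{cl}\operatorname{conv}H$ and $u\in\mathbb{R}^{\ell}$ such that $$z-\operatorname{cl}\operatorname{conv}H\subset\operatorname{int}C\cup\{0\}\quad\text{and}\quad (F-u)\cap\operatorname{int}C=\emptyset.$$ Then $M_{F,a,H,k}$ is nonempty and compact.
   Context: $\ell\ge 1$ is an integer. For $A\subseteq\mathbb{R}^{\ell}$, the recession cone is $0^+A:=\{u\in\mathbb{R}^{\ell}\mid A+\mathbb{R}_+u\subseteq A\}$, where $\mathbb{R}_+=[0,\infty)$; $\operatorname{core}$, $\operatorname{int}$, $\operatorname{cl}$, $\operatorname{conv}$ denote the algebraic interior, topological interior, closure and convex hull. A proper subset of $\mathbb{R}^{\ell}$ is a nonempty subset different from $\mathbb{R}^{\ell}$. A polyhedral cone is a set of the form $\{x\in\mathbb{R}^{\ell}\mid Bx\le 0\}$ for some real matrix $B$. $(P_{F,a,H,k})$ is the problem of minimizing $t$ over all pairs $(y,t)\in F\times\mathbb{R}$ with $y\in a-H+tk$ (the feasible solutions). $M_{F,a,H,k}$ is the set of its optimal solutions $y$, i.e. of all $y\in F$ for which there is $t\in\mathbb{R}$ such that $(y,t)$ is feasible and $t\le s$ for every feasible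 $(z,s)$. *)

(* Defs.v *)
From HB Require Import structures.
From mathcomp Require Import all_boot all_order all_algebra.
From mathcomp Require Import all_classical all_reals all_analysis.
Import Order.TTheory GRing.Theory Num.Theory.
Import numFieldNormedType.Exports.

Set Implicit Arguments.
Unset Strict Implicit.
Unset Printing Implicit Defensive.

Local Open Scope classical_set_scope.
Local Open Scope ring_scope.

(* This development is based on MathComp-Analysis. R^l is the space 'rV[R]_l
   of row vectors with its product topology. *)

Section LinearSpace.
Context {R : realType} {V : lmodType R}.
Implicit Types A : set V.

Definition recession_cone A : set V :=
  [set u | [set x + t *: u | x in A & t in `[0, +oo[ ] `<=` A].

(* Taking v = 0 shows that core A is included in A. *)
Definition core A : set V :=
  [set x | forall v : V, exists2 e : R, 0 < e &
     forall t : R, 0 <= t <= e -> A (x + t *: v)].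

Definition convex_hull A : set V := smallest (@convex_set R V) A.

Definition proper_subset A : Prop := A !=set0 /\ A <> setT.

End LinearSpace.

Definition polyhedral_cone {R : realType} {l : nat} (C : set 'rV[R]_l) : Prop :=
  exists (m : nat) (B : 'M[R]_(m, l)),
    C = [set x : 'rV[R]_l | forall i : 'I_m, (B *m x^T) i 0 <= 0].

Section ScalarizationProblem.
Context {R : realType} {V : lmodType R}.
Implicit Types (F H : set V) (a k : V).

Definition feasible F a H k : set (V * R) :=
  [set p | F p.1 /\ [set a - h + p.2 *: k | h in H] p.1].

Definition minimizers F a H k : set V :=
  [set y | exists t : R, feasible F a H k (y, t) /\
     forall (z : V) (s : R), feasible F a H k (z, s) -> t <= s].

End ScalarizationProblem.

(* Main.v *)
(* Write K for the closed convex hull of H. An asymptotic direction v of a level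
   set F `&` (a + t k - H) satisfies z - v \in K with v <> 0, hence v lies in
   int C; far points of the level set would then lie in u + int C, which F avoids.
   So level sets are compact. Since k is interior to the recession cone of H and
   H is not the whole space, t is bounded below on bounded sets of feasible
   points. The optimal value is therefore attained, and the minimizers form the
   level set at that value. *)
Require Import Defs.
From mathcomp Require Import all_boot all_order all_algebra.
From mathcomp Require Import all_classical all_reals all_analysis.
From mathcomp Require Import ring.
Import Order.TTheory GRing.Theory Num.Theory.
Import numFieldNormedType.Exports.
Set Implicit Arguments.
Unset Strict Implicit.
Unset Printing Implicit Defensive.

Local Open Scope classical_set_scope.
Local Open Scope ring_scope.

(** * Recession cones as convex cones, and balls around their core points *)

Lemma recession_coneP (R : realType) (V : lmodType R) (A : set V) (u : V) :
  recession_cone A u <-> forall x t, A x -> 0 <= t -> A (x + t *: u).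
Proof.
split=> [Au x t Ax t0|Au _ [x Ax [t /= + <-]]].
  by apply: Au; exists x => //; exists t => //=; rewrite in_itv/= t0.
by rewrite in_itv/= andbT; exact: Au.
Qed.

Lemma recession_coneD (R : realType) (V : lmodType R) (A : set V) (u v : V) :
  recession_cone A u -> recession_cone A v -> recession_cone A (u + v).
Proof.
move=> /recession_coneP Au /recession_coneP Av; apply/recession_coneP.
move=> x t Ax t0; rewrite scalerDr addrA; apply: Av => //; exact: Au.
Qed.

Lemma recession_coneZ (R : realType) (V : lmodType R) (A : set V) (r : R)
    (u : V) :
  0 <= r -> recession_cone A u -> recession_cone A (r *: u).
Proof.
move=> r0 /recession_coneP Au; apply/recession_coneP => x t Ax t0.
by rewrite scalerA; apply: Au => //; exact: mulr_ge0.
Qed.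

Lemma recession_cone0 (R : realType) (V : lmodType R) (A : set V) :
  recession_cone A 0.
Proof. by apply/recession_coneP => x t Ax _; rewrite scaler0 addr0. Qed.

Lemma recession_cone_sum (R : realType) (V : lmodType R) (A : set V)
    (I : Type) (s : seq I) (P : pred I) (f : I -> V) :
  (forall i, P i -> recession_cone A (f i)) ->
  recession_cone A (\sum_(i <- s | P i) f i).
Proof.
move=> Af; elim/big_ind : _ => //; first exact: recession_cone0.
exact: recession_coneD.
Qed.

Lemma mx_entry_le_norm (R : realType) (m n : nat) (x : 'M[R]_(m, n)) i j :
  `|x i j| <= `|x|.
Proof.
by rewrite [leRHS]/Num.norm /= mx_normrE; apply/bigmax_geP; right;
  exists (i, j).
Qed.

(* [l k + w] is the sum over the axes of [k + w_i delta_i]. *)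
Lemma core_recession_cone_ball (R : realType) (l : nat) (A : set 'rV[R]_l)
    (k : 'rV[R]_l) :
  (0 < l)%N -> core (recession_cone A) k ->
  exists2 e : R, 0 < e & forall w, `|w| <= e -> recession_cone A (k + w).
Proof.
move=> l0 kA.
have /choice[d dA] (i : 'I_l) : exists d : R, 0 < d /\
    forall t, `|t| <= d -> recession_cone A (k + t *: delta_mx 0 i).
  (* [core] only gives steps [t >= 0], so each axis is treated in both orientations. *)
  have [d1 d10 Ad1] := kA (delta_mx 0 i).
  have [d2 d20 Ad2] := kA (- delta_mx 0 i).
  exists (Num.min d1 d2); split; first by rewrite lt_min d10.
  move=> t; rewrite le_min => /andP[t1 t2]; have [t0|t0] := leP 0 t.
    by apply: Ad1; rewrite t0 -(ger0_norm t0).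
  rewrite -[t]opprK scaleNr -scalerN; apply: Ad2.
  by rewrite oppr_ge0 (ltW t0) -(ltr0_norm t0).
(* The default [1] of the minimum keeps [e] positive. The radius is [e / l] because the [i]-th
   summand moves by [l * w_i] along its axis. *)
pose e : R := \big[Num.min/1]_i d i.
have e0 : 0 < e.
  rewrite /e; elim/big_ind : _ => // [x y x0 y0|i _].
    by rewrite lt_min x0.
  by have [] := dA i.
have l0' : 0 < l%:R :> R by rewrite ltr0n.
exists (e / l%:R); first by rewrite divr_gt0.
move=> w we.
have -> : k + w = l%:R^-1 *: \sum_(i < l) (k + (l%:R * w 0 i) *: delta_mx 0 i).
  rewrite big_split/= sumr_const card_ord -[k *+ l]scaler_nat.
  under eq_bigr do rewrite -scalerA.
  rewrite -scaler_sumr -row_sum_delta -scalerDr scalerA.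
  by rewrite mulVf ?scale1r// gt_eqF.
apply: recession_coneZ; first by rewrite invr_ge0 ltW.
apply: recession_cone_sum => i _; apply: (dA i).2.
rewrite normrM gtr0_norm// mulrC -ler_pdivlMr//.
apply: (le_trans (mx_entry_le_norm w 0 i)); apply: (le_trans we).
by rewrite ler_pM2r ?invr_gt0//; exact: bigmin_le.
Qed.

(** * Scaling of cones, closed convex hulls, directions of unbounded sets *)

(** The preimage of [C] under division by [r] is a neighbourhood of [r *: x], and stability of [C]
    under [r] places it inside [C]. *)
Lemma interior_scale (R : realType) (V : normedModType R) (C : set V) (r : R)
    (x : V) :
  0 < r -> (forall y, C y -> C (r *: y)) -> interior C x -> interior C (r *: x).
Proof.
move=> r0 Cr Cx; have r_neq0 : r != 0 by rewrite gt_eqF.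
have : nbhs (r *: x) [set y | C (r^-1 *: y)].
  apply: (@scaler_continuous R V r^-1 (r *: x) C).
  by rewrite scalerA mulVf// scale1r.
by apply: filterS => y /= /Cr; rewrite scalerA mulfV// scale1r.
Qed.

Lemma polyhedral_coneZ (R : realType) (l : nat) (C : set 'rV[R]_l) (r : R) x :
  polyhedral_cone C -> 0 <= r -> C x -> C (r *: x).
Proof.
move=> [m [B ->]] r0 /= Cx i.
by rewrite linearZ/= -scalemxAr mxE mulr_ge0_le0.
Qed.

Lemma closureP_norm (R : realType) (V : normedModType R) (A : set V) (x : V) :
  closure A x <-> forall e : R, 0 < e -> exists2 y, A y & `|x - y| < e.
Proof.
split=> [Ax e e0|Ax B /nbhs_ballP[e /= e0 eB]].
  have [y [Ay]] := Ax _ (nbhsx_ballx x e e0).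
  by rewrite -ball_normE /= => xy; exists y.
have [y Ay xy] := Ax _ e0; exists y; split => //.
by apply: eB; rewrite -ball_normE.
Qed.

Lemma convex_hullP (R : realType) (V : lmodType R) (A : set V) (x y : V)
    (p : R) :
  0 <= p <= 1 -> convex_hull A x -> convex_hull A y ->
  convex_hull A (p *: x + (1 - p) *: y).
Proof.
move=> p01 Ax Ay B [/= Bconv AB].
have Bx : B x by apply: Ax.
have By : B y by apply: Ay.
have := Bconv x y (Itv01 (andP p01).1 (andP p01).2).
by rewrite !inE => /(_ Bx By).
Qed.

Lemma closure_convex_hullP (R : realType) (V : normedModType R) (A : set V)
    (x y : V) (p : R) :
  0 <= p <= 1 -> closure (convex_hull A) x -> closure (convex_hull A) y ->
  closure (convex_hull A) (p *: x + (1 - p) *: y).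
Proof.
move=> /andP[p0 p1] /closureP_norm Ax /closureP_norm Ay.
apply/closureP_norm => e e0.
have e20 : 0 < e / 2 by rewrite divr_gt0.
have [x' Ax' xx'] := Ax _ e20; have [y' Ay' yy'] := Ay _ e20.
exists (p *: x' + (1 - p) *: y').
  by apply: convex_hullP => //; rewrite p0.
rewrite opprD addrACA -!scalerBr [e]splitr (le_lt_trans (ler_normD _ _))//.
have q0 : 0 <= 1 - p by rewrite subr_ge0.
rewrite !normrZ !ger0_norm//.
rewrite ltrD//.
  by rewrite (le_lt_trans _ xx')// ler_piMl.
by rewrite (le_lt_trans _ yy')// ler_piMl// lerBlDr lerDl.
Qed.

(** Points of norm above [n], once normalized, form a sequence in the compact unit sphere; [v] is
    one of its cluster points. *)
Lemma unbounded_direction (R : realType) (l : nat) (A : set 'rV[R]_l) :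
  (forall M : R, exists2 y, A y & M < `|y|) ->
  exists2 v : 'rV[R]_l, `|v| = 1 &
    forall e M : R, 0 < e ->
      exists y, [/\ A y, M < `|y| & `|v - `|y|^-1 *: y| < e].
Proof.
move=> Aunb.
have /choice[y yA] (n : nat) : exists y, A y /\ n%:R < `|y|.
  by have [y Ay ny] := Aunb n%:R; exists y.
have y0 n : 0 < `|y n| by apply: le_lt_trans (yA n).2.
pose w n : 'rV[R]_l := `|y n|^-1 *: y n.
have w1 n : `|w n| = 1.
  by rewrite normrZ ger0_norm ?invr_ge0// mulVf ?gt_eqF.
pose S := [set x : 'rV[R]_l | `|x| = 1].
have cS : compact S.
  apply: bounded_closed_compact.
    exists 1; split => // M M1 x /= ->; exact: ltW.
  rewrite (_ : S = Num.norm @^-1` [set 1 : R])//.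
  apply: preimage_closed; last exact: closed_eq.
  by move=> x _; exact: norm_continuous.
have [v [v1 vcl]] : S `&` cluster (w @ \oo) !=set0.
  by apply: cS; apply: (@filterE _ \oo) => n; exact: w1.
exists v => // e M e0.
(* A cluster point is approached along every tail, so the point of [A] can be chosen both far out
   and close to [v] in direction. *)
have wM : (w @ \oo) [set w n | n in [set n | M < n%:R]].
  change (\forall n \near \oo, [set w n | n in [set n | M < n%:R]] (w n)).
  near=> n; exists n => //=.
  by near: n; exact: nbhs_infty_gtr.
have [_ [[n Mn <-]]] := vcl _ _ wM (nbhsx_ballx v e e0).
rewrite -ball_normE /= => vw; exists (y n); split => //; first exact: (yA n).1.
exact: lt_trans Mn (yA n).2.
Unshelve. all: by end_near. Qed.

(** * Level sets of the scalarization problem *)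

Section Levels.
Context (R : realType) (l : nat) (F H : set 'rV[R]_l) (a k : 'rV[R]_l).

Let K := closure (convex_hull H).

(** Solving [y = a - h + t *: k] for [h] removes the existential over [H] and turns closedness into
    a question about preimages. *)
Definition level (t : R) : set 'rV[R]_l := F `&` [set y | H (a + t *: k - y)].

Lemma feasibleE y t : feasible F a H k (y, t) <-> level t y.
Proof.
rewrite /feasible /level /=; split=> -[Fy].
  move=> [h Hh yE]; split=> //; rewrite -yE.
  rewrite [X in H X](_ : _ = h)//.
  by apply/rowP => i; rewrite !mxE; ring.
move=> Hy; split=> //; exists (a + t *: k - y) => //.
by apply/rowP => i; rewrite !mxE; ring.
Qed.

Lemma level_closed t : closed F -> closed H -> closed (level t).
Proof.
move=> cF cH; apply: closedI => //.
have cf : continuous (fun y : 'rV[R]_l => a + t *: k - y).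
  move=> y; apply: (@cvgB R 'rV[R]_l 'rV[R]_l (nbhs y) _ (fun=> _) id).
    exact: cvg_cst.
  exact: cvg_id.
by apply: (@preimage_closed _ _ _ H) => // y _; exact: cf.
Qed.

Lemma level_bounded t (C : set 'rV[R]_l) z u :
  (forall r x, 0 <= r -> C x -> C (r *: x)) -> K z ->
  [set z - h | h in K] `<=` interior C `|` [set 0] ->
  [set y - u | y in F] `&` interior C = set0 ->
  bounded_set (level t).
Proof.
move=> Cr Kz zKC FuC; apply: contrapT => unb.
have {unb} : forall M : R, exists2 y, level t y & M < `|y|.
  move=> M; apply: contrapT => hM; apply: unb; exists M.
  split; first exact: num_real.
  move=> N MN y Ly /=; rewrite (le_trans _ (ltW MN))// leNgt; apply/negP => My.
  by apply: hM; exists y.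
move=> /unbounded_direction[v v1 vdir].
(* [(1 - 1/|y|) z + h/|y|], with [h := a + t k - y \in H], tends to [z - v]. *)
have Kzv : K (z - v).
  suff : closure K (z - v) by rewrite -((closure_id K).1 (@closed_closure _ _)).
  apply/closureP_norm => e e0; have e20 : 0 < e / 2 by rewrite divr_gt0.
  pose c := a + t *: k - z.
  (* Norm above [1] makes [|y|^-1] a convex weight; norm above [|c| / (e / 2)] makes the error
     [|y|^-1 *: c] smaller than [e / 2]. *)
  have [y [[_ /= Hy] yM vy]] := vdir (e / 2) (Num.max 1 (`|c| / (e / 2))) e20.
  move: yM; rewrite gt_max => /andP[y1 yc].
  have y0 : 0 < `|y| := lt_trans ltr01 y1.
  exists (`|y|^-1 *: (a + t *: k - y) + (1 - `|y|^-1) *: z).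
    apply: closure_convex_hullP => //.
      by rewrite invr_ge0 ltW//= invf_le1// ltW.
    apply: subset_closure; exact: sub_gen_smallest.
  have -> : z - v - (`|y|^-1 *: (a + t *: k - y) + (1 - `|y|^-1) *: z) =
      - ((v - `|y|^-1 *: y) + `|y|^-1 *: c).
    rewrite /c !scalerBr scalerBl scale1r; move: (_ *: (a + _)) => b.
    move: (_ *: y) (_ *: z) => b1 b2.
    by apply/rowP => i; rewrite !mxE; ring.
  rewrite normrN [e]splitr (le_lt_trans (ler_normD _ _))// ltrD// normrZ.
  rewrite ger0_norm ?invr_ge0//.
  by rewrite mulrC ltr_pdivrMr// mulrC -ltr_pdivrMr.
(* The alternative [v = 0] is excluded by [|v| = 1]. *)
have Cv : interior C v.
  have [|//|v0] := zKC v.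
    by exists (z - v) => //; rewrite opprB addrC subrK.
  by move: v1; rewrite v0 normr0 => /esym/eqP; rewrite oner_eq0.
have [e /= e0 eC] : nbhs_ball v (interior C).
  by apply/nbhs_ballP; exact: nbhs_interior.
have e20 : 0 < e / 2 by rewrite divr_gt0.
(* For such [y], the vector [|y|^-1 *: (y - u)] is within [e] of [v]; scaling back by [|y|] then
   puts [y - u] in the interior of [C]. *)
have [y [[Fy _] yM vy]] := vdir (e / 2) (Num.max 0 (`|u| / (e / 2))) e20.
move: yM; rewrite gt_max => /andP[y0 yu].
have : interior C (`|y|^-1 *: (y - u)).
  apply: eC; rewrite -ball_normE /= scalerBr opprB addrCA addrC [e]splitr.
  rewrite (le_lt_trans (ler_normD _ _))// ltrD// normrZ ger0_norm ?invr_ge0//.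
  by rewrite mulrC ltr_pdivrMr// mulrC -ltr_pdivrMr.
move=> /(interior_scale y0 (fun x => Cr _ x (ltW y0))).
rewrite scalerA mulfV ?gt_eqF// scale1r => Cyu.
suff : set0 (y - u) by [].
by rewrite -FuC; split => //; exists y.
Qed.

(** If the bound failed, [t] would be negative and [w = (- t)^-1 *: (x0 - a + y)] shorter than [e].
    Going from [a + t *: k - y] in [H] by [- t] times the recession direction [k + w] would then
    reach exactly [x0]. *)
Lemma level_lower_bound (e : R) (x0 y : 'rV[R]_l) t :
  0 <= e -> (forall w, `|w| <= e -> recession_cone H (k + w)) -> ~ H x0 ->
  level t y ->
  - t * e <= `|x0 - a + y|.
Proof.
move=> e0 kH Hx0 [_ /= Hy]; rewrite leNgt; apply/negP => ylt.
have [t0|t0] := leP 0 t.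
  move: ylt; rewrite ltNge (le_trans _ (normr_ge0 _))//.
  by rewrite mulr_le0_ge0 ?oppr_le0.
apply: Hx0; have nt0 : 0 < - t by rewrite oppr_gt0.
have kw : recession_cone H (k + (- t)^-1 *: (x0 - a + y)).
  apply: kH; rewrite normrZ gtr0_norm ?invr_gt0//.
  by rewrite mulrC ler_pdivrMr// mulrC ltW.
have := (recession_coneP _ _).1 kw _ _ Hy (ltW nt0).
rewrite scalerDr scalerA mulfV ?gt_eqF// scale1r.
rewrite [X in H X -> _](_ : _ = x0)//.
by apply/rowP => i; rewrite !mxE; ring.
Qed.

Lemma level_nondecreasing s t :
  recession_cone H k -> s <= t -> level s `<=` level t.
Proof.
move=> /recession_coneP kH st y [Fy /= Hy]; split => //=.
have := kH _ (t - s) Hy; rewrite subr_ge0 => /(_ st).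
rewrite [X in H X -> _](_ : _ = a + t *: k - y)//.
by apply/rowP => i; rewrite !mxE; ring.
Qed.

(** For small [e > 0], [k + e *: (a - y - h)] is a recession direction; moving [h] along it by
    [e^-1] gives [a + e^-1 *: k - y]. *)
Lemma level_neq0 : core (recession_cone H) k -> F !=set0 -> H !=set0 ->
  exists t, level t !=set0.
Proof.
move=> kH [y Fy] [h Hh]; have [e e0 ke] := kH (a - y - h).
exists e^-1, y; split => //=.
have kv : recession_cone H (k + e *: (a - y - h)).
  by apply: ke; rewrite lexx ltW.
have ei0 : 0 <= e^-1 by rewrite invr_ge0 ltW.
have := (recession_coneP _ _).1 kv _ _ Hh ei0.
rewrite scalerDr scalerA mulVf ?gt_eqF// scale1r.
rewrite [X in H X -> _](_ : _ = a + e^-1 *: k - y)//.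
by apply/rowP => i; rewrite !mxE; ring.
Qed.

(** All optimal solutions share one value, so compactness of their set reduces to that of a single
    level set. *)
Lemma minimizersE y t : feasible F a H k (y, t) ->
  (forall z s, feasible F a H k (z, s) -> t <= s) ->
  minimizers F a H k = level t.
Proof.
move=> yt tmin; apply/seteqP; split => [z [s [zs smin]]|z zt].
  suff <- : s = t by apply/feasibleE.
  by apply/eqP; rewrite eq_le (smin _ _ yt) (tmin _ _ zs).
by exists t; split => //; apply/feasibleE.
Qed.

End Levels.

Theorem proposition8 (R : realType) (l : nat) (hl : (1 <= l)%N)
  (F H : set 'rV[R]_l) (a k : 'rV[R]_l)
  (F_nonempty : F !=set0) (F_closed : closed F)
  (H_proper : proper_subset H) (H_closed : closed H)
  (k_recession : (recession_cone H `\ 0) k)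
  (k_core : core (recession_cone H) k)
  (hC : exists (C : set 'rV[R]_l) (z u : 'rV[R]_l),
     [/\ polyhedral_cone C,
         closure (convex_hull H) z,
         [set z - h | h in closure (convex_hull H)] `<=` interior C `|` [set 0] &
         [set y - u | y in F] `&` interior C = set0]) :
  minimizers F a H k !=set0 /\ compact (minimizers F a H k).
Proof.
have [C [z [u [Cpoly Kz zKC FuC]]]] := hC.
have Lbounded t : bounded_set (level F H a k t).
  by apply: level_bounded Kz zKC FuC => r x; exact: polyhedral_coneZ.
have Lcompact t : compact (level F H a k t).
  by apply: bounded_closed_compact => //; exact: level_closed.
have [H0 HT] := H_proper.
have [x0 Hx0] : exists x0, ~ H x0.
  by apply/existsNP => HA; apply: HT; rewrite -subTset.
have [e e0 ke] := core_recession_cone_ball hl k_core.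
have [t0 [y0 Ly0]] := level_neq0 a k_core F_nonempty H0.
have [r Lr] : exists r : R, forall y, level F H a k t0 y -> `|y| <= r.
  have [M [_ LM]] := Lbounded t0.
  by exists (M + 1); apply: LM; rewrite ltrDl.
(* For [t <= t0] the level at [t] lies in the level at [t0], so its points have norm at most [r],
   and the bound [- t * e <= |x0 - a + y|] gives [m <= t]. *)
pose m := - ((`|x0 - a| + r) / e).
have tm y t : level F H a k t y -> t <= t0 -> m <= t.
  move=> Ly tt0.
  have := level_lower_bound (ltW e0) ke Hx0 Ly => tle.
  rewrite lerNl ler_pdivlMr//; apply: (le_trans tle).
  rewrite (le_trans (ler_normD _ _))// lerD2l.
  by apply: Lr; apply: level_nondecreasing tt0 _ Ly; case: k_recession.
(* The feasible pairs with value at most [t0]: a closed subset of the compact product of the level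
   at [t0] with [[m, t0]], on which [snd] attains its minimum. *)
pose A := [set p : 'rV[R]_l * R | level F H a k p.2 p.1 /\ p.2 <= t0].
have cA : compact A.
  apply: (@subclosed_compact _ _ (level F H a k t0 `*` `[m, t0]%classic)).
  - rewrite (_ : A = fst @^-1` F `&`
        ((fun p : 'rV[R]_l * R => a + p.2 *: k - p.1) @^-1` H `&`
        snd @^-1` `]-oo, t0]%classic)).
      apply: closedI; first by apply: preimage_closed => // p _; exact: cvg_fst.
      apply: closedI; last first.
        apply: preimage_closed; last exact: lray_closed.
        by move=> p _; exact: cvg_snd.
      apply: preimage_closed => // p _.
      apply: (@cvgB R 'rV[R]_l _ (nbhs p) _ _ fst); last exact: cvg_fst.
      apply: (@cvgD R 'rV[R]_l _ (nbhs p) _ (fun=> a)); first exact: cvg_cst.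
      by apply: cvgZ; [exact: cvg_snd|exact: cvg_cst].
    apply/seteqP; split=> [[y t] [[/= Fy Hy] tt0]|[y t] /= [Fy [Hy tt0]]].
      by split => //; split => //=; rewrite in_itv.
    by rewrite in_itv in tt0.
  - by apply: compact_setX => //; exact: segment_compact.
  - move=> [y t] [/= Ly tt0]; split => /=.
      by apply: level_nondecreasing tt0 _ Ly; case: k_recession.
    by rewrite in_itv/= tt0 (tm y).
have [||[y t] + tmin] := @compact_EVT_min _ R snd A _ cA.
- by exists (y0, t0); split.
- by apply: continuous_subspaceT => p; exact: cvg_snd.
rewrite inE => -[/= Ly tt0].
rewrite (@minimizersE _ _ _ _ _ _ y t); first by split => //; exists y.
  by apply/feasibleE.
(* Pairs with [s > t0] lie outside [A] but cannot improve on [t <= t0]. *)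
move=> w s /feasibleE Lw; have [st0|/ltW t0s] := leP s t0.
  by apply: (tmin (w, s)); rewrite inE.
exact: le_trans t0s.
Qed.
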